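(* Let $C$ be a subset of $\{r,t,e\}$. (a) If $M=(\Sigma,\mathcal{K}_1,\dots,\mathcal{K}_n,\pi,\{\rho_{\Psi',\Psi}:\Psi\subseteq\Psi'\subseteq\Phi\})\in\mathcal{H}_n^C(\Phi)$, then there exists an awareness structure $M'=(\Sigma,\mathcal{K}_1',\dots,\mathcal{K}_n',\pi',\mathcal{A}_1,\dots,\mathcal{A}_n)\in\mathcal{N}_n^{C,pg}(\Phi)$ (with the same state set $\Sigma$) such that, for all $\varphi\in\mathcal{L}^K_n(\Phi)$, if $s\in S_\Psi$ and $\Phi_\varphi\subseteq\Psi$, then $(M,s)\models\varphi$ iff $(M',s)\models\varphi_X$. Moreover, if $C\cap\{t,e\}\neq\emptyset$, then we can take $M'\in\mathcal{N}_n^{C,pd}(\Phi)$. (b) If $M=(\Sigma,\mathcal{K}_1,\dots,\mathcal{K}_n,\pi,\mathcal{A}_1,\dots,\mathcal{A}_n)\in\mathcal{N}_n^{C,pd}(\Phi)$, then there exists an HMS structure $M'=(\Sigma',\mathcal{K}_1',\dots,\mathcal{K}_n',\pi',\{\rho_{\Psi',\Psi}:\Psi\subseteq\Psi'\subseteq\Phi\})\in\mathcal{H}_n^C(\Phi)$ such that $\Sigma'=\Sigma\times2^\Phi$, $S_\Psi=\Sigma\times\{\Psi\}$ for all $\Psi\subseteq\Phi$, and, for all $\varphi\in\mathcal{L}^K_n(\Phi)$, if $\Phi_\varphi\subseteq\Psi$, then $(M,s)\models\varphi_X$ iff $(M',(s,\Psi))\models\varphi$. If $\{t,e\}\cap C=\emptyset$,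 then the result holds even if $M\in\mathcal{N}_n^{C,pg}(\Phi)-\mathcal{N}_n^{C,pd}(\Phi)$.
   Context: Languages. $\Phi$ is a set of primitive propositions, $n\ge1$ a number of agents. $\mathcal{L}^K_n(\Phi)$ is built from $\Phi$ and $\top$ using $\neg,\wedge,K_1,\dots,K_n$; $\mathcal{L}^{K,X,A}_n(\Phi)$ additionally has modal operators $X_i,A_i$; $\mathcal{L}^X_n(\Phi)$ is the sublanguage of the latter not mentioning any $K_i$ or $A_i$. $\varphi\vee\psi$ and $\varphi\Rightarrow\psi$ abbreviate $\neg(\neg\varphi\wedge\neg\psi)$ and $\neg\varphi\vee\psi$. $\Phi_\varphi$ is the set of primitive propositions appearing in $\varphi$. For $\varphi\in\mathcal{L}^K_n(\Phi)$, $\varphi_X\in\mathcal{L}^X_n(\Phi)$ is obtained by replacing every $K_i$ by $X_i$. HMS structures. An HMS structure for $n$ agents over $\Phi$ is a tuple $(\Sigma,\mathcal{K}_1,\dots,\mathcal{K}_n,\pi,\{\rho_{\Psi',\Psi}:\Psi\subseteq\Psi'\subseteq\Phi\})$ where $\Sigma=\bigcup_{\Psi\subseteq\Phi}S_\Psi$ is a disjoint union of sets of states; $\mathcal{K}_i:\Sigma\to2^\Sigma$; $\pi:\Sigma\times\Phi\to\{0,1,1/2\}$ is such that for $s\in S_\Psi$, $\pi(s,p)\ne1/2$ iff $p\in\Psi$; each $\rho_{\Psi',\Psi}$ maps $S_{\Psi'}$ onto $S_\Psi$ (intuitively, $\rho_{\Psi',\Psi}(s)$ is a description of the state $s\in S_{\Psi'}$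 in the less expressive vocabulary of $S_\Psi$); and for $\Psi_1\subseteq\Psi_2\subseteq\Psi_3$, $\rho_{\Psi_2,\Psi_1}(\rho_{\Psi_3,\Psi_2}(s))=\rho_{\Psi_3,\Psi_1}(s)$ for all $s\in S_{\Psi_3}$. For $B\subseteq S_\Psi$ let $B^\uparrow=\bigcup_{\Psi'\supseteq\Psi}\rho_{\Psi',\Psi}^{-1}(B)$; for $B\subseteq S_{\Psi_2}$, $\rho_{\Psi_2,\Psi_1}(B)$ denotes the image of $B$. Truth in HMS structures for $\mathcal{L}^K_n(\Phi)$: for $s\in S_\Psi$, if $\Phi_\varphi\not\subseteq\Psi$ then $\varphi$ is undefined at $s$ (neither $\varphi$ nor $\neg\varphi$ is true). If $\Phi_\varphi\subseteq\Psi$: $(M,s)\models\top$; $(M,s)\models p$ iff $\pi(s,p)=1$; $(M,s)\models\neg\varphi$ iff $(M,s)\not\models\varphi$; $(M,s)\models\varphi\wedge\psi$ iff both are true at $s$; $(M,s)\models K_i\varphi$ iff $(M,t)\models\varphi$ for all $t\in\mathcal{K}_i(s)$. Conditions. Confinedness: if $s\in S_\Psi$ then $\mathcal{K}_i(s)\subseteq S_{\Psi'}$ for some $\Psi'\subseteq\Psi$. Generalized reflexivity ($r$): $s\in\mathcal{K}_i(s)^\uparrow$ for all $s$. Stationarity (a) ($t$): $s'\in\mathcal{K}_i(s)$ implies $\mathcal{K}_i(s')\subseteq\mathcal{K}_i(s)$. Stationarity (b) ($e$): $s'\in\mathcal{K}_i(s)$ implies $\mathcal{K}_i(s')\supseteq\mathcal{K}_i(s)$.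 Projections preserve knowledge: if $\Psi_1\subseteq\Psi_2\subseteq\Psi_3$, $s\in S_{\Psi_3}$ and $\mathcal{K}_i(s)\subseteq S_{\Psi_2}$, then $\rho_{\Psi_2,\Psi_1}(\mathcal{K}_i(s))=\mathcal{K}_i(\rho_{\Psi_3,\Psi_1}(s))$. Projections preserve ignorance: if $s\in S_{\Psi'}$ and $\Psi\subseteq\Psi'$ then $(\mathcal{K}_i(s))^\uparrow\subseteq(\mathcal{K}_i(\rho_{\Psi',\Psi}(s)))^\uparrow$. For $C\subseteq\{r,t,e\}$, $\mathcal{H}_n^C(\Phi)$ is the class of HMS structures over $\Phi$ satisfying confinedness, projections preserve knowledge, projections preserve ignorance, and the conditions in $C$ (for all agents). Awareness structures. An awareness structure over $\Phi$ is $(\Sigma,\mathcal{K}_1,\dots,\mathcal{K}_n,\pi,\mathcal{A}_1,\dots,\mathcal{A}_n)$ with $\mathcal{K}_i:\Sigma\to2^\Sigma$, $\pi:\Sigma\times\Phi\to\{0,1\}$, and $\mathcal{A}_i$ assigning to each state a set of formulas. Truth is the standard 2-valued Kripke semantics ($K_i\varphi$ true at $s$ iff $\varphi$ is true at all $t\in\mathcal{K}_i(s)$) with $(M,s)\models A_i\varphi$ iff $\varphi\in\mathcal{A}_i(s)$, and $(M,s)\models X_i\varphi$ iff $(M,s)\models A_i\varphi$ and $(M,s)\models K_i\varphi$. Awareness is generated by primitive propositions (propositionally generated) if for all $i,s$: $\varphi\in\mathcal{A}_i(s)$ iff $\Phi_\varphi\subseteq\mathcal{A}_i(s)$. Agents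 know what they are aware of if $t\in\mathcal{K}_i(s)$ implies $\mathcal{A}_i(s)=\mathcal{A}_i(t)$. The structure is propositionally determined if both hold. $\mathcal{N}_n^{C,pg}(\Phi)$ (resp. $\mathcal{N}_n^{C,pd}(\Phi)$) is the class of awareness structures over $\Phi$ where awareness is propositionally generated (resp. that are propositionally determined) and whose $\mathcal{K}_i$ satisfy the conditions in $C$: here $r$ is reflexive ($s\in\mathcal{K}_i(s)$), $t$ is transitive ($t\in\mathcal{K}_i(s)\Rightarrow\mathcal{K}_i(t)\subseteq\mathcal{K}_i(s)$), $e$ is Euclidean ($t\in\mathcal{K}_i(s)\Rightarrow\mathcal{K}_i(t)\supseteq\mathcal{K}_i(s)$).
   Formalization: In (a), if r∈C, it is also assumed that projections preserve truth values: π(ρ_{Ψ',Ψ}(s),p)=π(s,p) for s∈S_{Ψ'}, p∈Ψ⊆Ψ'. In (b), if r∉C, it is also assumed that K_i(s)=∅ implies agent i is aware of all formulas at s. Without these the claims fail. *)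

(* Defs.v *)
From mathcomp Require Import all_boot.
From mathcomp Require Import boolp classical_sets.

Set Implicit Arguments.
Unset Strict Implicit.
Unset Printing Implicit Defensive.

Local Open Scope classical_set_scope.

(* Languages over a set [Phi] of primitive propositions, with agents 'I_n *)

Inductive formK (n : nat) (Phi : Type) : Type :=
| KVar of Phi
| KTop
| KNeg of formK n Phi
| KAnd of formK n Phi & formK n Phi
| KKnow of 'I_n & formK n Phi.

Inductive formKXA (n : nat) (Phi : Type) : Type :=
| Var of Phi
| Top
| Neg of formKXA n Phi
| And of formKXA n Phi & formKXA n Phi
| Know of 'I_n & formKXA n Phi
| Xknow of 'I_n & formKXA n Phi
| Aware of 'I_n & formKXA n Phi.

Arguments KVar {n Phi} _.
Arguments KTop {n Phi}.
Arguments Var {n Phi} _.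
Arguments Top {n Phi}.

Fixpoint propsK n Phi (f : formK n Phi) : set Phi :=
  match f with
  | KVar p => [set p]
  | KTop => set0
  | KNeg g => propsK g
  | KAnd g h => propsK g `|` propsK h
  | KKnow _ g => propsK g
  end.

Fixpoint props n Phi (f : formKXA n Phi) : set Phi :=
  match f with
  | Var p => [set p]
  | Top => set0
  | Neg g => props g
  | And g h => props g `|` props h
  | Know _ g => props g
  | Xknow _ g => props g
  | Aware _ g => props g
  end.

Fixpoint toX n Phi (f : formK n Phi) : formKXA n Phi :=
  match f with
  | KVar p => Var p
  | KTop => Top
  | KNeg g => Neg (toX g)
  | KAnd g h => And (toX g) (toX h)
  | KKnow i g => Xknow i (toX g)
  end.

(* The labels r, t, e.  What each one means depends on the kind of structure,
   see [hms_cond] and [aw_cond]. *)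
Inductive condition := Cr | Ct | Ce.

(* HMS structures *)

Inductive truth := TFalse | TTrue | THalf.

(* The disjoint union of the S_Psi is given by its total space [Sigma] and the
   map [hvocab] sending s in S_Psi to Psi; S_Psi itself is [hspace M Psi].
   [hrho Psi' Psi] stands for a map S_Psi' -> S_Psi, for Psi included in Psi':
   only its values on S_Psi', in that case, are constrained or used. *)
Record hms (n : nat) (Phi Sigma : Type) := HMS {
  hvocab : Sigma -> set Phi;
  hposs : 'I_n -> Sigma -> set Sigma;
  hval : Sigma -> Phi -> truth;
  hrho : set Phi -> set Phi -> Sigma -> Sigma;
  hval_half : forall (s : Sigma) (p : Phi),
    hval s p <> THalf <-> hvocab s p;
  hrho_onto : forall Psi Psi' : set Phi, Psi `<=` Psi' ->
    hrho Psi' Psi @` [set s | hvocab s = Psi'] = [set s | hvocab s = Psi];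
  hrho_comp : forall Psi1 Psi2 Psi3 : set Phi,
    Psi1 `<=` Psi2 -> Psi2 `<=` Psi3 ->
    forall s : Sigma, hvocab s = Psi3 ->
      hrho Psi2 Psi1 (hrho Psi3 Psi2 s) = hrho Psi3 Psi1 s
}.

Definition hspace n Phi Sigma (M : hms n Phi Sigma) (Psi : set Phi)
  : set Sigma := [set s | hvocab M s = Psi].

(* The first conjunct makes a formula whose propositions are not all in the
   vocabulary of s undefined at s: neither it nor its negation holds there. *)
Fixpoint hsat n Phi Sigma (M : hms n Phi Sigma) (f : formK n Phi) (s : Sigma)
  {struct f} : Prop :=
  propsK f `<=` hvocab M s /\
  match f with
  | KVar p => hval M s p = TTrue
  | KTop => True
  | KNeg g => ~ hsat M g s
  | KAnd g h => hsat M g s /\ hsat M h s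
  | KKnow i g => forall t, hposs M i s t -> hsat M g t
  end.

(* For B included in S_Psi this is the union, over Psi' containing Psi, of the
   preimages of B under rho_{Psi',Psi}: a t in S_Psi' is only projected to
   spaces S_Psi0 with Psi0 included in Psi', and lands in B only if
   Psi0 = Psi. *)
Definition hup n Phi Sigma (M : hms n Phi Sigma) (B : set Sigma) : set Sigma :=
  [set t | exists2 Psi, Psi `<=` hvocab M t & B (hrho M (hvocab M t) Psi t)].

Definition confinedness n Phi Sigma (M : hms n Phi Sigma) : Prop :=
  forall (i : 'I_n) (Psi : set Phi) (s : Sigma), hspace M Psi s ->
    exists2 Psi', Psi' `<=` Psi & hposs M i s `<=` hspace M Psi'.

Definition gen_reflexivity n Phi Sigma (M : hms n Phi Sigma) : Prop :=
  forall (i : 'I_n) (s : Sigma), hup M (hposs M i s) s.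

Definition stationarity_a n Phi Sigma (M : hms n Phi Sigma) : Prop :=
  forall (i : 'I_n) (s s' : Sigma),
    hposs M i s s' -> hposs M i s' `<=` hposs M i s.

Definition stationarity_b n Phi Sigma (M : hms n Phi Sigma) : Prop :=
  forall (i : 'I_n) (s s' : Sigma),
    hposs M i s s' -> hposs M i s `<=` hposs M i s'.

Definition proj_knowledge n Phi Sigma (M : hms n Phi Sigma) : Prop :=
  forall (i : 'I_n) (Psi1 Psi2 Psi3 : set Phi) (s : Sigma),
    Psi1 `<=` Psi2 -> Psi2 `<=` Psi3 -> hspace M Psi3 s ->
    hposs M i s `<=` hspace M Psi2 ->
    hrho M Psi2 Psi1 @` hposs M i s = hposs M i (hrho M Psi3 Psi1 s).

Definition proj_ignorance n Phi Sigma (M : hms n Phi Sigma) : Prop :=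
  forall (i : 'I_n) (Psi Psi' : set Phi) (s : Sigma),
    hspace M Psi' s -> Psi `<=` Psi' ->
    hup M (hposs M i s) `<=` hup M (hposs M i (hrho M Psi' Psi s)).

Definition hms_cond n Phi Sigma (c : condition) (M : hms n Phi Sigma) : Prop :=
  match c with
  | Cr => gen_reflexivity M
  | Ct => stationarity_a M
  | Ce => stationarity_b M
  end.

Definition in_H n Phi Sigma (C : set condition) (M : hms n Phi Sigma) : Prop :=
  [/\ confinedness M, proj_knowledge M, proj_ignorance M &
      forall c, C c -> hms_cond c M].

(* rho_{Psi',Psi}(s) describes s in the vocabulary Psi: both states agree on
   the primitive propositions in Psi.  The conditions above do not imply it:
   they never mention the valuation. *)
Definition rho_describes n Phi Sigma (M : hms n Phi Sigma) : Prop :=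
  forall (Psi Psi' : set Phi) (s : Sigma) (p : Phi),
    Psi `<=` Psi' -> hspace M Psi' s -> Psi p ->
    hval M (hrho M Psi' Psi s) p = hval M s p.

(* Awareness structures *)

Record awstruct (n : nat) (Phi Sigma : Type) := AwStruct {
  aposs : 'I_n -> Sigma -> set Sigma;
  aval : Sigma -> Phi -> bool;
  aware : 'I_n -> Sigma -> set (formKXA n Phi)
}.

Fixpoint asat n Phi Sigma (M : awstruct n Phi Sigma) (f : formKXA n Phi)
  (s : Sigma) {struct f} : Prop :=
  match f with
  | Var p => aval M s p
  | Top => True
  | Neg g => ~ asat M g s
  | And g h => asat M g s /\ asat M h s
  | Know i g => forall t, aposs M i s t -> asat M g t
  | Xknow i g => aware M i s g /\ forall t, aposs M i s t -> asat M g t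
  | Aware i g => aware M i s g
  end.

Definition prop_generated n Phi Sigma (M : awstruct n Phi Sigma) : Prop :=
  forall (i : 'I_n) (s : Sigma) (f : formKXA n Phi),
    aware M i s f <-> (forall p, props f p -> aware M i s (Var p)).

Definition know_awareness n Phi Sigma (M : awstruct n Phi Sigma) : Prop :=
  forall (i : 'I_n) (s t : Sigma), aposs M i s t -> aware M i s = aware M i t.

Definition prop_determined n Phi Sigma (M : awstruct n Phi Sigma) : Prop :=
  prop_generated M /\ know_awareness M.

Definition aw_cond n Phi Sigma (c : condition) (M : awstruct n Phi Sigma)
  : Prop :=
  match c with
  | Cr => forall (i : 'I_n) (s : Sigma), aposs M i s s
  | Ct => forall (i : 'I_n) (s t : Sigma),
      aposs M i s t -> aposs M i t `<=` aposs M i s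
  | Ce => forall (i : 'I_n) (s t : Sigma),
      aposs M i s t -> aposs M i s `<=` aposs M i t
  end.

Definition in_Npg n Phi Sigma (C : set condition) (M : awstruct n Phi Sigma)
  : Prop := prop_generated M /\ forall c, C c -> aw_cond c M.

Definition in_Npd n Phi Sigma (C : set condition) (M : awstruct n Phi Sigma)
  : Prop := prop_determined M /\ forall c, C c -> aw_cond c M.

(* In an HMS structure an agent who considers no state possible knows every
   formula that is defined, so unawareness cannot be expressed there.  In an
   awareness structure such an agent may still be unaware of formulas; this
   condition excludes it.  It is vacuous when the relations are reflexive. *)
Definition aware_if_no_poss n Phi Sigma (M : awstruct n Phi Sigma) : Prop :=
  forall (i : 'I_n) (s : Sigma), aposs M i s = set0 -> aware M i s = setT.

(* Main.v *)
Require Import Defs.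
From mathcomp Require Import all_boot.
From mathcomp Require Import boolp classical_sets.

Local Open Scope classical_set_scope.

(** (a) An agent is aware at s of the propositions that lie in the vocabulary of
    s and of every state she considers possible; the vocabulary of s matters
    only when no state is possible.  The relations are kept, except that with r
    they are made reflexive: s is added to [K_i(s)], which already contains a
    projection of s.  This does not affect the truth of [K_i f], because under
    r a state and its projections satisfy the same formulas of the smaller
    vocabulary.
    (b) At (s, Psi) the agent considers possible the pairs of a state t in
    [K_i(s)] and the part of Psi that she is aware of at s: awareness becomes
    the vocabulary of the states considered possible. *)

(** * Projections, possibility sets and truth in HMS structures *)

Lemma hsat_props {n : nat} {Phi Sigma : Type} {M : hms n Phi Sigma}
    {f : formK n Phi} {s : Sigma} :
  hsat M f s -> propsK f `<=` hvocab M s.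
Proof. by case: f => [p||g|g h|i g] []. Qed.

Lemma hvocab_rho {n : nat} {Phi Sigma : Type} (M : hms n Phi Sigma)
    (Psi : set Phi) (s : Sigma) :
  Psi `<=` hvocab M s -> hvocab M (hrho M (hvocab M s) Psi s) = Psi.
Proof.
move=> sub; have /seteqP[im _] := hrho_onto M sub.
by apply: im; exists s.
Qed.

(* A surjective idempotent is the identity. *)
Lemma hrho_id {n : nat} {Phi Sigma : Type} (M : hms n Phi Sigma) (s : Sigma) :
  hrho M (hvocab M s) (hvocab M s) s = s.
Proof.
have sub := @subset_refl _ (hvocab M s).
have /seteqP[_ im] := hrho_onto M sub.
have [t /= ts {3 4}<-] := im s erefl.
by rewrite hrho_comp.
Qed.

Lemma subset_hup {n : nat} {Phi Sigma : Type} (M : hms n Phi Sigma)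
    (B : set Sigma) :
  B `<=` hup M B.
Proof. by move=> s Bs; exists (hvocab M s) => //; rewrite hrho_id. Qed.

(** A projection of [t] has exactly the vocabulary it is projected to, so landing in [B] forces that
    vocabulary to be [Psi]. *)
Lemma hup_vocab {n : nat} {Phi Sigma : Type} {M : hms n Phi Sigma}
    {B : set Sigma} {Psi : set Phi} {t : Sigma} :
  B `<=` hspace M Psi -> hup M B t ->
  Psi `<=` hvocab M t /\ B (hrho M (hvocab M t) Psi t).
Proof.
move=> BPsi [Psi0 sub Bt].
by have := BPsi _ Bt; rewrite /hspace /= hvocab_rho // => <-.
Qed.

Lemma hposs_neq0 {n : nat} {Phi Sigma : Type} {M : hms n Phi Sigma} :
  gen_reflexivity M -> forall (i : 'I_n) (s : Sigma), hposs M i s !=set0.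
Proof. by move=> refl i s; have [Psi _ Kt] := refl i s; eexists; exact: Kt. Qed.

(** Preservation of knowledge at [Psi1 = Psi2 = Psi], since [S_Psi] projects to itself
    identically. *)
Lemma hposs_rho_self {n : nat} {Phi Sigma : Type} {M : hms n Phi Sigma}
    {i : 'I_n} {s : Sigma} {Psi : set Phi} :
  proj_knowledge M -> Psi `<=` hvocab M s -> hposs M i s `<=` hspace M Psi ->
  hposs M i (hrho M (hvocab M s) Psi s) = hposs M i s.
Proof.
move=> know PsiS KPsi; have sub := @subset_refl _ Psi.
rewrite -(know i Psi Psi _ s sub PsiS erefl KPsi).
apply/seteqP; split=> [_ [t Kt <-]|t Kt].
  by rewrite -(KPsi _ Kt) hrho_id.
by exists t => //; rewrite -(KPsi _ Kt) hrho_id.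
Qed.

(* Preservation of ignorance from s to its projection, and from there to
   Psi `&` Psi2, pins down the space containing K_i of the projection. *)
Lemma hposs_rho {n : nat} {Phi Sigma : Type} {M : hms n Phi Sigma}
    {i : 'I_n} {s : Sigma} {Psi Psi2 : set Phi} :
  confinedness M -> proj_knowledge M -> proj_ignorance M ->
  gen_reflexivity M ->
  Psi `<=` hvocab M s -> Psi2 `<=` hvocab M s ->
  hposs M i s `<=` hspace M Psi2 ->
  hposs M i (hrho M (hvocab M s) Psi s) =
  hrho M Psi2 (Psi `&` Psi2) @` hposs M i s.
Proof.
move=> conf know ign refl PsiS Psi2S KPsi2.
set s1 := hrho _ _ _ _.
have s1Psi : hvocab M s1 = Psi by exact: hvocab_rho.
have K12 := know i (Psi `&` Psi2) Psi2 _ s (@subIsetr _ _ _) Psi2S erefl KPsi2.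
set s2 := hrho M _ (Psi `&` Psi2) s in K12.
have s2E : hrho M Psi (Psi `&` Psi2) s1 = s2.
  by rewrite /s1 hrho_comp //; exact: subIsetl.
have [Psi4 Psi4Psi KPsi4] := conf i Psi s1 s1Psi.
(* Generalized reflexivity supplies a state possible at [s]; by preservation of ignorance its
   vocabulary [Psi2] contains [Psi4]. *)
have Psi42 : Psi4 `<=` Psi2.
  have [t Kt] := hposs_neq0 refl i s.
  have up := ign i Psi _ s erefl PsiS t (subset_hup _ _ _ Kt).
  by have [] := hup_vocab KPsi4 up; rewrite (KPsi2 _ Kt).
have K2sub : hposs M i s2 `<=` hspace M (Psi `&` Psi2).
  move=> u; rewrite -K12 => -[t /KPsi2 tPsi2 <-]; rewrite -tPsi2.
  by apply: hvocab_rho; rewrite tPsi2; exact: subIsetr.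
have Psi14 : Psi `&` Psi2 `<=` Psi4.
  have [t Kt] := hposs_neq0 refl i s1.
  have := ign i (Psi `&` Psi2) _ s1 s1Psi (@subIsetl _ _ _) t
    (subset_hup _ _ _ Kt).
  by rewrite s2E => /(hup_vocab K2sub)[]; rewrite (KPsi4 _ Kt).
have eq4 : Psi4 = Psi `&` Psi2.
  by apply/seteqP; split => // p Hp; split; [exact: Psi4Psi|exact: Psi42].
(* [K_i(s1)] lies in [S_Psi4], so projecting [s1] to [Psi4], which gives [s2], leaves [K_i]
   unchanged. *)
rewrite K12 -s2E -eq4 -s1Psi.
by rewrite (hposs_rho_self know _ KPsi4) // s1Psi.
Qed.

(** For [KKnow], [hposs_rho] makes the states possible at the projection the projections of those
    possible at [s]; induction applies to each pair. *)
Lemma hsat_rho {n : nat} {Phi Sigma : Type} {M : hms n Phi Sigma} :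
  confinedness M -> proj_knowledge M -> proj_ignorance M ->
  gen_reflexivity M -> rho_describes M ->
  forall (f : formK n Phi) (s : Sigma) (Psi : set Phi),
    Psi `<=` hvocab M s -> propsK f `<=` Psi ->
    hsat M f (hrho M (hvocab M s) Psi s) <-> hsat M f s.
Proof.
move=> conf know ign refl descr.
elim=> [p||g IH|g IHg h IHh|i g IH] s Psi PsiS /= fPsi; rewrite hvocab_rho //;
  have fS := subset_trans fPsi PsiS.
- by rewrite (descr Psi _ s p PsiS erefl (fPsi p erefl)); split=> -[].
- by [].
- by have := IH s Psi PsiS fPsi; tauto.
- have [gPsi hPsi] : propsK g `<=` Psi /\ propsK h `<=` Psi.
    by split=> p Hp; apply: fPsi; [left|right].
  by have := IHg s Psi PsiS gPsi; have := IHh s Psi PsiS hPsi; tauto.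
have [Psi2 Psi2S KPsi2] := conf i _ s erefl.
have KE := hposs_rho conf know ign refl PsiS Psi2S KPsi2.
have subt t : hposs M i s t -> Psi `&` Psi2 `<=` hvocab M t.
  by move=> /KPsi2 ->; exact: subIsetr.
have rhot t : hposs M i s t ->
    hposs M i (hrho M (hvocab M s) Psi s)
      (hrho M (hvocab M t) (Psi `&` Psi2) t).
  by move=> Kt; rewrite KE (KPsi2 _ Kt); exists t.
split=> -[_ Kg]; split=> // t.
  move=> Kt; have gt := Kg _ (rhot t Kt).
  apply/(IH t _ (subt t Kt)) => //.
  by have := hsat_props gt; rewrite hvocab_rho //; exact: subt.
rewrite KE => -[u Ku <-]; have gu := Kg _ Ku.
rewrite -(KPsi2 _ Ku).
apply/IH => //.
by rewrite subsetI; split=> //; exact: hsat_props gu.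
Qed.

(** * From HMS structures to awareness structures *)

Definition aware_props {n : nat} {Phi Sigma : Type} (M : hms n Phi Sigma)
    (i : 'I_n) (s : Sigma) : set Phi :=
  [set p | hvocab M s p /\ forall t, hposs M i s t -> hvocab M t p].

(* In [K_i(s)] generalized reflexivity puts only a projection of s.  Adding s
   itself preserves transitivity but not Euclideanness; in the presence of e,
   adding all t with [K_i(t) = K_i(s)] yields an equivalence relation. *)
Definition refl_poss {n : nat} {Phi Sigma : Type} (C : set condition)
    (M : hms n Phi Sigma) (i : 'I_n) (s : Sigma) : set Sigma :=
  [set t | hposs M i s t \/
    C Cr /\ (t = s \/ C Ce /\ hposs M i t = hposs M i s)].

Definition aw_of_hms {n : nat} {Phi Sigma : Type} (C : set condition)
    (M : hms n Phi Sigma) : awstruct n Phi Sigma :=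
  {| aposs := refl_poss C M;
     aval := fun s p => `[< hval M s p = TTrue >];
     aware := fun i s => [set f | props f `<=` aware_props M i s] |}.

Lemma props_toX {n : nat} {Phi : Type} (f : formK n Phi) :
  props (toX f) = propsK f.
Proof. by elim: f => //= g -> h ->. Qed.

Lemma refl_poss_cases {n : nat} {Phi Sigma : Type} {C : set condition}
    {M : hms n Phi Sigma} {i : 'I_n} {s t : Sigma} :
  refl_poss C M i s t ->
  hposs M i s t \/ C Cr /\ hposs M i t = hposs M i s.
Proof.
by move=> [Kt|[Cr_ [->|[_ E]]]]; [left|right; split|right; split].
Qed.

Lemma hsat_aw_of_hms {n : nat} {Phi Sigma : Type} (C : set condition)
    (M : hms n Phi Sigma) :
  in_H C M -> (C Cr -> rho_describes M) ->
  forall (f : formK n Phi) (s : Sigma), propsK f `<=` hvocab M s ->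
    (hsat M f s <-> asat (aw_of_hms C M) (toX f) s).
Proof.
move=> [conf know ign conds] descr.
elim=> [p||g IH|g IHg h IHh|i g IH] s /= fS.
- by split=> [[_ ?]|/asboolP]; [apply/asboolP|split].
- by split.
- by have := IH s fS; tauto.
- have [gS hS] : propsK g `<=` hvocab M s /\ propsK h `<=` hvocab M s.
    by split=> p Hp; apply: fS; [left|right].
  by have := IHg s gS; have := IHh s hS; tauto.
rewrite props_toX; split=> [[_ Kg]|[gA Kg]]; last first.
  split=> // t Kt; apply/IH; last by apply: Kg; left.
  by move=> p /gA[_]; apply.
split=> [p gp|t /refl_poss_cases[Kt|[Cr_ Kts]]].
(* Truth of [g] at a possible state includes being defined there, which yields awareness. *)
- by split=> [|t /Kg gt]; [exact: fS|exact: hsat_props gt _ gp].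
- by apply/IH; [exact: hsat_props (Kg _ Kt)|exact: Kg].
(* [K_i(t) = K_i(s)] contains a projection of the added state [t]; [g] is true there, hence at
   [t]. *)
have refl : gen_reflexivity M := conds Cr Cr_.
have [Psi PsiT] := refl i t; rewrite Kts => /Kg gt.
have gPsi := hsat_props gt; rewrite hvocab_rho // in gPsi.
apply/IH; first exact: subset_trans PsiT.
by apply/(hsat_rho conf know ign refl (descr Cr_) _ _ _ PsiT gPsi).
Qed.

(** By confinedness the states of [K_i(s)] share one vocabulary, included in that of [s]. *)
Lemma aware_props_poss {n : nat} {Phi Sigma : Type} {M : hms n Phi Sigma}
    {i : 'I_n} {s t : Sigma} :
  confinedness M -> hposs M i s t -> aware_props M i s = hvocab M t.
Proof.
move=> conf Kt; have [Psi PsiS KPsi] := conf i _ s erefl.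
apply/seteqP; split=> p; first by move=> [_]; apply.
rewrite (KPsi _ Kt) => Hp; split=> [|u /KPsi ->] //; exact: PsiS.
Qed.

Lemma aware_props_know {n : nat} {Phi Sigma : Type} {C : set condition}
    {M : hms n Phi Sigma} {i : 'I_n} {s t : Sigma} :
  in_H C M -> C Ct \/ C Ce -> hposs M i s t ->
  aware_props M i s = aware_props M i t.
Proof.
move=> [conf _ _ conds] Cte Kt.
rewrite (aware_props_poss conf Kt).
(* If nothing is possible at [t], the agent is aware there of the whole vocabulary of [t]. *)
have [[u Ktu]|/nonemptyPn Kt0] := pselect (hposs M i t !=set0); last first.
  by apply/seteqP; split=> p; rewrite /aware_props /= Kt0; [split|case].
(* Transitivity puts [u] in [K_i(s)], so [u] and [t] share a vocabulary; Euclideanness puts [t] in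
   [K_i(t)]. *)
case: Cte => [/conds trans|/conds eucl].
  rewrite (aware_props_poss conf Ktu) -(aware_props_poss conf Kt).
  by rewrite (aware_props_poss conf (trans _ _ _ Kt _ Ktu)).
by rewrite (aware_props_poss conf (eucl _ _ _ Kt _ Kt)).
Qed.

(* The link is the projection t0 of s in [K_i(s)]: [K_i(t0) = K_i(s)] because
   projections preserve knowledge. *)
Lemma hposs_eq {n : nat} {Phi Sigma : Type} {M : hms n Phi Sigma} :
  confinedness M -> proj_knowledge M -> gen_reflexivity M ->
  stationarity_b M ->
  forall (i : 'I_n) (s t : Sigma),
    hposs M i s t -> hposs M i t = hposs M i s.
Proof.
move=> conf know refl eucl i s t Kt.
have [Psi PsiS KPsi] := conf i _ s erefl.
have [_ Ks0] := hup_vocab KPsi (refl i s).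
apply/seteqP; split; last exact: eucl Kt.
apply: subset_trans (eucl _ _ _ (eucl _ _ _ Kt _ Ks0)) _.
by rewrite (hposs_rho_self know PsiS KPsi).
Qed.

Lemma aw_of_hms_cond {n : nat} {Phi Sigma : Type} (C : set condition)
    (M : hms n Phi Sigma) :
  in_H C M -> forall c, C c -> aw_cond c (aw_of_hms C M).
Proof.
move=> [conf know ign conds].
(* Under r and e the enlarged relation is equality of [K_i], which makes t and e immediate. *)
have KE : C Cr -> C Ce -> forall i s t,
    refl_poss C M i s t <-> hposs M i t = hposs M i s.
  move=> Cr_ Ce_ i s t; split=> [/refl_poss_cases[|[]//]|E]; last first.
    by right; split=> //; right.
  exact: hposs_eq (conds Cr Cr_) (conds Ce Ce_) i s t.
case=> Cc i s /=; first by right; split=> //; left.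
- move=> t st u tu; have trans := conds Ct Cc.
  have [[Cr_ Ce_]|nCre] := pselect (C Cr /\ C Ce).
    by move: st tu; rewrite !KE // => <-.
  (* Otherwise each state gains at most itself: additions need r, and e is then excluded. *)
  case: tu => [Ku|[Cr_ [->//|[Ce_ _]]]]; last by case: nCre.
  case: st => [Kt|[Cr_ [<-|[Ce_ _]]]]; last by case: nCre.
    by left; exact: trans Kt _ Ku.
  by left.
move=> t st u su; have eucl := conds Ce Cc.
have [Cr_|nCr] := pselect (C Cr).
  by move: st su; rewrite !KE // => ->.
case: st => [Kt|[]//]; case: su => [Ku|[]//].
by left; exact: eucl Kt _ Ku.
Qed.

Lemma aw_of_hms_generated {n : nat} {Phi Sigma : Type} (C : set condition)
    (M : hms n Phi Sigma) :
  prop_generated (aw_of_hms C M).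
Proof. by move=> i s f; split=> [fA p fp _ ->|fA p /fA]; [exact: fA|apply]. Qed.

Lemma aw_of_hms_know {n : nat} {Phi Sigma : Type} (C : set condition)
    (M : hms n Phi Sigma) :
  in_H C M -> C Ct \/ C Ce -> know_awareness (aw_of_hms C M).
Proof.
move=> HM Cte i s t /refl_poss_cases st /=.
suff -> : aware_props M i s = aware_props M i t by [].
case: st => [|[Cr_ E]]; first exact: aware_props_know HM Cte.
have [conf _ _ conds] := HM.
(* Both states consider [u] possible, so both awareness sets are the vocabulary of [u]. *)
have [u Ku] := hposs_neq0 (conds Cr Cr_) i s.
have Ktu : hposs M i t u by rewrite E.
by rewrite (aware_props_poss conf Ku) (aware_props_poss conf Ktu).
Qed.

(** * From awareness structures to HMS structures *)

Definition aware_vars {n : nat} {Phi Sigma : Type} (M : awstruct n Phi Sigma)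
    (i : 'I_n) (s : Sigma) : set Phi :=
  [set p | aware M i s (Var p)].

Definition pair_val {n : nat} {Phi Sigma : Type} (M : awstruct n Phi Sigma)
    (x : Sigma * set Phi) (p : Phi) : truth :=
  if `[< x.2 p >] then (if aval M x.1 p then TTrue else TFalse) else THalf.

Lemma pair_val_half {n : nat} {Phi Sigma : Type} (M : awstruct n Phi Sigma)
    (x : Sigma * set Phi) (p : Phi) :
  pair_val M x p <> THalf <-> x.2 p.
Proof. by rewrite /pair_val; case: asboolP; case: (aval M x.1 p); split. Qed.

Lemma pair_rho_onto {Phi Sigma : Type} (Psi Psi' : set Phi) :
  Psi `<=` Psi' ->
  (fun x : Sigma * set Phi => (x.1, Psi)) @` [set x | x.2 = Psi'] =
  [set x | x.2 = Psi].
Proof.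
move=> _; apply/seteqP; split=> [_ [x _ <-] //|[s _] /= ->].
by exists (s, Psi').
Qed.

Definition hms_of_aw {n : nat} {Phi Sigma : Type} (M : awstruct n Phi Sigma) :
    hms n Phi (Sigma * set Phi) :=
  {| hvocab := snd;
     hposs := fun i x =>
       [set y | aposs M i x.1 y.1 /\ y.2 = x.2 `&` aware_vars M i x.1];
     hval := pair_val M;
     hrho := fun _ Psi x => (x.1, Psi);
     hval_half := pair_val_half M;
     hrho_onto := @pair_rho_onto Phi Sigma;
     hrho_comp := fun _ _ _ _ _ _ _ => erefl |}.

Lemma hms_of_aw_in_H {n : nat} {Phi Sigma : Type} (C : set condition)
    (M : awstruct n Phi Sigma) :
  (forall c, C c -> aw_cond c M) -> (C Ct \/ C Ce -> know_awareness M) ->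
  in_H C (hms_of_aw M).
Proof.
move=> conds know; split.
- move=> i _ x /= <-; exists (x.2 `&` aware_vars M i x.1).
    exact: subIsetl.
  by move=> y [].
- move=> i Psi1 Psi2 Psi' [s Psi3] sub12 _ /= _ KPsi2.
  (* Once [K_i(s)] has an element, [Psi2] is [Psi3] restricted to awareness, so the agent is aware
     of all of [Psi1]. *)
  have A1 t : aposs M i s t -> Psi1 `&` aware_vars M i s = Psi1.
    move=> Kt; apply/setIidPl; apply: subset_trans sub12 _.
    rewrite -(KPsi2 (t, Psi3 `&` aware_vars M i s)) //=; exact: subIsetr.
  apply/seteqP; split=> [_ [[t _] [/= Kt _] <-]|[t _] [/= Kt ->]].
    by split=> //=; rewrite (A1 t).
  by exists (t, Psi3 `&` aware_vars M i s); rewrite //= (A1 t).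
- move=> i Psi _ [s Psi'] /= <- sub [t Th] [Psi0 /= sub0 [/= Kt E]].
  (* A smaller vocabulary meets awareness in a smaller set, so the projection can go further
     down. *)
  exists (Psi `&` aware_vars M i s) => //=.
  by apply: subset_trans sub0; rewrite E; exact: setSI.
- case=> Cc.
  + move=> i x; exists (x.2 `&` aware_vars M i x.1); first exact: subIsetl.
    by split=> //; exact: (conds Cr Cc).
  + move=> i [s Psi] [t _] [/= Kt ->] [u _] [/= Ku ->]; split=> /=.
      exact: (conds Ct Cc) Kt _ Ku.
    (* Equal awareness at [s] and [t] makes restricting the vocabulary twice the same as once. *)
    by rewrite /aware_vars -(know (or_introl Cc) _ _ _ Kt) -setIA setIid.
  + move=> i [s Psi] [t _] [/= Kt ->] [u _] [/= Ku ->]; split=> /=.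
      exact: (conds Ce Cc) Kt _ Ku.
    by rewrite /aware_vars -(know (or_intror Cc) _ _ _ Kt) -setIA setIid.
Qed.

Lemma hsat_hms_of_aw {n : nat} {Phi Sigma : Type} (M : awstruct n Phi Sigma) :
  prop_generated M -> aware_if_no_poss M ->
  forall (f : formK n Phi) (s : Sigma) (Psi : set Phi), propsK f `<=` Psi ->
    (asat M (toX f) s <-> hsat (hms_of_aw M) f (s, Psi)).
Proof.
move=> gen noposs.
elim=> [p||g IH|g IHg h IHh|i g IH] s Psi /= fPsi.
- have /asboolP Psip : Psi p by exact: fPsi.
  by rewrite /pair_val /= Psip; case: (aval M s p); split=> // -[].
- by split.
- by have := IH s Psi fPsi; tauto.
- have [gPsi hPsi] : propsK g `<=` Psi /\ propsK h `<=` Psi.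
    by split=> p Hp; apply: fPsi; [left|right].
  by have := IHg s Psi gPsi; have := IHh s Psi hPsi; tauto.
have awareE : aware M i s (toX g) <-> propsK g `<=` aware_vars M i s.
  by rewrite gen props_toX.
split=> [[/awareE gA Kg]|[_ Kg]].
  split=> // -[t _] [/= Kt ->]; apply/IH; last exact: Kg.
  by rewrite subsetI.
have gI t : aposs M i s t -> hsat (hms_of_aw M) g (t, Psi `&` aware_vars M i s).
  by move=> Kt; apply: Kg.
split=> [|t /gI gt]; last by apply/(IH t _ (hsat_props gt)).
(* At a possible [t], [g] is defined in a vocabulary within the agent's awareness; with no such [t],
   [aware_if_no_poss] applies. *)
have [K0|/eqP/set0P[t /gI /hsat_props]] := pselect (aposs M i s = set0).
  by rewrite (noposs _ _ K0).
by rewrite subsetI => -[_ /awareE].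
Qed.

Theorem theorem3p2 (n : nat) (n_ge1 : (1 <= n)%N) (Phi : Type)
    (C : set condition) :
  (forall (Sigma : Type) (M : hms n Phi Sigma),
     in_H C M ->
     (C Cr -> rho_describes M) ->
     exists M' : awstruct n Phi Sigma,
       [/\ in_Npg C M',
           (C `&` [set Ct; Ce] !=set0 -> in_Npd C M') &
           forall (f : formK n Phi) (Psi : set Phi) (s : Sigma),
             hspace M Psi s -> propsK f `<=` Psi ->
             (hsat M f s <-> asat M' (toX f) s)])
  /\
  (forall (Sigma : Type) (M : awstruct n Phi Sigma),
     in_Npd C M \/
       [/\ [set Ct; Ce] `&` C = set0, in_Npg C M & ~ in_Npd C M] ->
     (~ C Cr -> aware_if_no_poss M) ->
     exists M' : hms n Phi (Sigma * set Phi),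
       [/\ in_H C M',
           rho_describes M',
           (forall Psi : set Phi, hspace M' Psi = [set: Sigma] `*` [set Psi]) &
           forall (f : formK n Phi) (s : Sigma) (Psi : set Phi),
             propsK f `<=` Psi ->
             (asat M (toX f) s <-> hsat M' f (s, Psi))]).
Proof.
split=> Sigma M.
  move=> HM descr; exists (aw_of_hms C M).
  have conds := aw_of_hms_cond C M HM.
  have gen := aw_of_hms_generated C M.
  split=> [//|[c [Cc cte]]|f Psi s <-]; last exact: hsat_aw_of_hms.
  split=> //; split=> //; apply: aw_of_hms_know => //.
  by case: cte Cc => ->; [left|right].
move=> MC noposs; exists (hms_of_aw M).
have [conds gen know] : [/\ forall c, C c -> aw_cond c M, prop_generated M &
    C Ct \/ C Ce -> know_awareness M].
  case: MC => [[[gen know] conds] //|[C0 [gen conds] _]].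
  split=> // Cte; exfalso; suff : set0 Ct \/ set0 Ce by case.
  by rewrite -C0; case: Cte; [left|right]; split=> //; [left|right].
have nop : aware_if_no_poss M.
  (* Reflexivity leaves no [K_i(s)] empty. *)
  have [Cr_ i s K0|] := pselect (C Cr); last exact: noposs.
  suff : set0 s by [].
  by rewrite -K0; exact: (conds Cr Cr_).
split.
- exact: hms_of_aw_in_H.
- move=> Psi _ [s Psi'] p /[swap] /= <- sub Psip; rewrite /pair_val /=.
  by rewrite !asboolT //; exact: sub.
- by move=> Psi; apply/seteqP; split=> [[s T]|[s T] []].
- by move=> f s Psi; exact: hsat_hms_of_aw.
Qed.
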